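(* Let $q:[t_0,+\infty)\to\mathbb{R}$ be locally integrable. Suppose that for some $\lambda\in\mathbb{R}$ the following conditions are satisfied: A) $\displaystyle \lim_{t\to+\infty}\frac1t\int_{t_0}^td\tau\int_{t_0}^\tau q(s)\,ds=\lambda$; B) for all sufficiently large $t$, $$\frac1t\int_{t_0}^td\tau\int_{t_0}^\tau q(s)\,ds\le\lambda-\frac{\ln Q_0(t)}{4t}+\frac{Q_1(t)}{t},$$ where $Q_0,Q_1$ are some real-valued continuous functions on $[t_0,+\infty)$ satisfying $Q_0(t)>0$ for $t\ge t_0$, $\displaystyle\int_{t_0}^{+\infty}\frac{d\tau}{Q_0(\tau)}<+\infty$, and $\displaystyle\sup_{t\ge t_0}Q_1(t)<+\infty$. Then the equation $\phi''(t)+q(t)\phi(t)=0$, $t\ge t_0$, is oscillatory.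
   Context: $t_0$ is a fixed real number. The equation $\phi''+q\phi=0$, $t\ge t_0$, is said to be oscillatory if every solution of it has arbitrarily large zeros. The notation $\int_{t_0}^t d\tau\int_{t_0}^\tau q(s)\,ds$ means $\int_{t_0}^t\left(\int_{t_0}^\tau q(s)\,ds\right)d\tau$. *)

(* Defs.v *)
(* MathComp-Analysis *)
From HB Require Import structures.
From mathcomp Require Import all_boot all_order all_algebra.
From mathcomp Require Import all_classical all_reals all_analysis.
Set Implicit Arguments.
Unset Strict Implicit.
Unset Printing Implicit Defensive.
Import Order.TTheory GRing.Theory Num.Theory.
Import numFieldNormedType.Exports.
Local Open Scope classical_set_scope.
Local Open Scope ring_scope.

(* [completed_lebesgue_measure] is used because [lebesgue_measure] only knows
   Borel sets, whereas integrable means Lebesgue integrable here.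
   Functions on [t0, +oo) are represented by functions R -> R whose values
   outside [t0, +oo) are irrelevant. *)

Definition locally_integrable_from (R : realType) (t0 : R) (q : R -> R) : Prop :=
  forall T : R, t0 <= T ->
    (@completed_lebesgue_measure R).-integrable `[t0, T] (EFin \o q).

Definition iterated_integral (R : realType) (t0 : R) (q : R -> R) (t : R) : R :=
  \int[@completed_lebesgue_measure R]_(tau in `[t0, t])
    \int[@completed_lebesgue_measure R]_(s in `[t0, tau]) q s.

(* The finitely many intervals [p.1, p.2] may share endpoints. *)
Definition absolutely_continuous_on (R : realType) (a b : R) (f : R -> R) : Prop :=
  forall e : R, 0 < e -> exists2 d : R, 0 < d &
    forall s : seq (R * R),
      all (fun p => (a <= p.1) && (p.1 <= p.2) && (p.2 <= b)) s ->
      pairwise (fun p r => (p.2 <= r.1) || (r.2 <= p.1)) s ->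
      \sum_(p <- s) (p.2 - p.1) < d ->
      \sum_(p <- s) `|f p.2 - f p.1| < e.

(* For t = t0 this is the right derivative, for t > t0 the usual one. *)
Definition is_derivative_from (R : realType) (t0 : R) (f : R -> R) (t l : R) : Prop :=
  (f s - f t) / (s - t) @[s --> within `[t0, +oo[ t^'] --> l.

(* As q is only locally integrable, phi'' + q phi = 0 is understood in the sense
   of Caratheodory: phi' (called psi) exists everywhere and is locally absolutely
   continuous, and the equation holds almost everywhere. *)
Definition is_solution (R : realType) (t0 : R) (q phi : R -> R) : Prop :=
  exists psi : R -> R,
    [/\ forall t, t0 <= t -> is_derivative_from t0 phi t (psi t),
        forall T, t0 <= T -> absolutely_continuous_on t0 T psi &
        {ae @completed_lebesgue_measure R, forall t, t0 <= t ->
          exists2 l : R, is_derivative_from t0 psi t l & l + q t * phi t = 0}].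

Definition oscillatory (R : realType) (t0 : R) (q : R -> R) : Prop :=
  forall phi : R -> R, is_solution t0 q phi ->
    forall T : R, exists t : R, [/\ t0 <= t, T <= t & phi t = 0].

(* Main.v *)
Require Import Defs.
From HB Require Import structures.
From mathcomp Require Import all_boot all_order all_algebra.
From mathcomp Require Import all_classical all_reals all_analysis.
From mathcomp Require Import measurable_realfun.
From mathcomp Require Import ring lra.
Import Order.TTheory GRing.Theory Num.Theory.
Import numFieldNormedType.Exports.
Local Open Scope classical_set_scope.
Local Open Scope ring_scope.

(** A solution [phi] that never vanishes on a half-line [a, +oo) yields the
    function [y = phi' / phi], which satisfies the Riccati equation
    [y' + y^2 + q = 0]. With [P t] the integral of [q] over [t0, t], [I] a
    primitive of [P] (the iterated integral of the statement), [W] the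
    primitive of [y^2] vanishing at [a], [V] a primitive of [W] and [Y] one of
    [y], the integrated equation reads [y = c - P - W]
    ([riccati_identity]), hence [Y = c t - I - V].

    Since [I t / t] has a finite limit, [W] is bounded
    ([riccati_square_bounded]). Indeed [V] would otherwise grow faster than
    any linear function, so that [Y t - Y a] would be at most [- V t / 2], and the
    Cauchy-Schwarz inequality [(Y t - Y a)^2 <= (t - a) W t] would give
    [V^2 <= 4 t V'], which is impossible on a half-line because [1/t] has a
    divergent integral.

    Let [w] be the supremum of [W] and [U] a primitive of [w - W]. Both [Y] and
    [U] are [o(t)], so [c - w = lambda] and [lambda t - I t = Y t - U t].
    Completing a square bounds the derivative of [Y - U + t (w - W)] by
    [y - t y^2 <= 1 / (4 t)], hence [lambda t - I t <= ln t / 4 + K]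
    ([riccati_deficit_bound]). Condition B bounds the same quantity from below
    by [ln (Q0 t) / 4] up to a constant, so [Q0 t <= M t] eventually, and the
    integral of [1 / Q0] diverges ([integral_inverse_linear_infinite]).

    The derivative of [phi'] and the Riccati equation hold only almost
    everywhere. The integrated form comes from the fact that an absolutely
    continuous function whose derivative vanishes almost everywhere is
    constant ([ac_derive0_ae_eq]), applied to [y + P + W]. That [P' = q] almost
    everywhere is the Lebesgue differentiation theorem, stated for Borel
    functions; [q] is therefore replaced by a Borel function that agrees with
    it almost everywhere ([locally_integrable_representative]). *)

(** * Comparison of functions by their derivatives *)

Lemma nondecreasing_of_derive_ge0 (R : realType) (a : R) (F f : R -> R) :
  (forall t, a <= t -> is_derive t 1 F (f t)) ->
  (forall t, a <= t -> 0 <= f t) ->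
  forall u v, a <= u -> u <= v -> F u <= F v.
Proof.
move=> dF f0 u v au uv.
have [||c cuv] := @MVT_segment R F f u v uv.
- by move=> x; rewrite in_itv/= => /andP[ux _]; apply: dF; apply: le_trans au (ltW ux).
- apply: derivable_within_continuous => x; rewrite in_itv/= => /andP[ux _].
  by have := dF x (le_trans au ux) => -[].
move: cuv; rewrite in_itv/= => /andP[uc _] e.
by rewrite -subr_ge0 e mulr_ge0 ?subr_ge0 ?f0// (le_trans au).
Qed.

Lemma le_of_derive_le (R : realType) (a : R) (F f G g : R -> R) :
  (forall t, a <= t -> is_derive t 1 F (f t)) ->
  (forall t, a <= t -> is_derive t 1 G (g t)) ->
  (forall t, a <= t -> f t <= g t) ->
  forall u v, a <= u -> u <= v -> F v - F u <= G v - G u.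
Proof.
move=> dF dG fg u v au uv.
have := @nondecreasing_of_derive_ge0 R a (G - F) (g - f) _ _ u v au uv.
rewrite !fctE => h; suff : G u - F u <= G v - F v by lra.
apply: h => t ta; last by rewrite subr_ge0 fg.
have := dF t ta; have := dG t ta => *; exact: is_deriveB.
Qed.

Lemma near_pinfty_ge (R : realType) (a : R) (P : R -> Prop) :
  (\forall t \near +oo, P t) -> exists2 T, a <= T & forall t, T <= t -> P t.
Proof.
move=> [M [_ MP]]; exists (Num.max a (M + 1)); first by rewrite le_max lexx.
by move=> t; rewrite ge_max => /andP[_ Mt]; apply: MP; apply: lt_le_trans Mt; rewrite ltrDl.
Qed.

(** The integral of [(y - k)^2] over [a, t] is nonnegative. Keeping [k] free
    instead of optimising it avoids square roots; its sign is free too, so the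
    inequality bounds [Y t - Y a] from both sides. *)
Lemma integral_cauchy_schwarz (R : realType) (a : R) (y Y W : R -> R) :
  (forall t, a <= t -> is_derive t 1 Y (y t)) ->
  (forall t, a <= t -> is_derive t 1 W (y t ^+ 2)) ->
  forall k t, a <= t ->
    2 * k * (Y t - Y a) <= W t - W a + k ^+ 2 * (t - a).
Proof.
move=> dY dW k t at_.
have := @le_of_derive_le R a (fun s => 2 * k * Y s) (fun s => 2 * k * y s)
  (fun s => W s + k ^+ 2 * s) (fun s => y s ^+ 2 + k ^+ 2) _ _ _ a t (lexx a) at_.
move=> h; have : 2 * k * Y t - 2 * k * Y a <= W t + k ^+ 2 * t - (W a + k ^+ 2 * a).
  apply: h => s sa.
  - have := dY s sa => ?; exact: (is_deriveZ (2 * k)).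
  - have := dW s sa => ?.
    exact: (is_derive_eq (is_deriveD _ (is_deriveZ (k ^+ 2) (is_derive_id s 1)))
        (congr1 (+%R _) (mulr1 _))).
  - by have := sqr_ge0 (y s - k); nra.
by nra.
Qed.

(** * Averages of the Riccati equation *)

(** If [W] were unbounded, [V] would dominate every linear function, in
    particular [c t - I t]; then [- (Y t - Y a)] would be at least [V t / 2] and
    Cauchy-Schwarz would turn into the differential inequality
    [V^2 <= 4 t V'], which blows up in finite time: [1 / V + ln t / 4] would be
    nonincreasing. *)
Lemma riccati_square_bounded (R : realType) (a c lambda : R)
    (I V W y Y : R -> R) :
  0 < a ->
  t^-1 * I t @[t --> +oo] --> lambda ->
  (forall t, a <= t -> is_derive t 1 Y (y t)) ->
  (forall t, a <= t -> is_derive t 1 V (W t)) ->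
  (forall t, a <= t -> is_derive t 1 W (y t ^+ 2)) ->
  W a = 0 ->
  (forall t, a <= t -> Y t = c * t - I t - V t) ->
  exists w, forall t, a <= t -> W t <= w.
Proof.
move=> a0 Icvg dY dV dW Wa YE; apply: contrapT => unb.
have Wmono : forall u v, a <= u -> u <= v -> W u <= W v.
  by apply: (@nondecreasing_of_derive_ge0 _ _ _ _ dW) => t _; exact: sqr_ge0.
(* eventually [c t - I t - Y a <= L t] *)
pose L := `|lambda| + 1 + `|c| + 1.
have [T1 aT1 WT1] : exists2 T, a <= T & 2 * L + 1 < W T.
  apply: contrapT => h; apply: unb; exists (2 * L + 1) => t at_.
  by rewrite leNgt; apply/negP => Wt; apply: h; exists t.
have [T2 T12 IT2] : exists2 T, Num.max T1 `|Y a| <= T &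
    forall t, T <= t -> `|lambda - t^-1 * I t| < 1.
  by apply: near_pinfty_ge; move/cvgrPdist_lt : Icvg; apply.
move: T12; rewrite ge_max => /andP[T12 YaT2].
have L0 : 0 < L by rewrite /L; have := normr_ge0 lambda; have := normr_ge0 c; lra.
have lam := ler_norm lambda; have lam' := ler_norm (- lambda).
have cc := ler_norm c; have cc' := ler_norm (- c).
rewrite !normrN in lam' cc'.
have Vbig t : T2 <= t -> V T2 + (2 * L + 1) * (t - T2) <= V t.
  move=> T2t.
  have := @le_of_derive_le R T2 (fun s => (2 * L + 1) * s) (fun=> 2 * L + 1) V W
    _ _ _ T2 t (lexx _) T2t.
  move=> h; have : (2 * L + 1) * t - (2 * L + 1) * T2 <= V t - V T2; last by lra.
  apply: h => s sT2.
  - exact: (is_derive_eq (is_deriveZ (2 * L + 1) (is_derive_id s 1)) (mulr1 _)).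
  - by apply: dV; lra.
  - by apply: le_trans (ltW WT1) _; apply: Wmono => //; lra.
(* from [T3] on, the slope [2 L + 1] has made up for the initial value [V T2] *)
pose T3 := T2 + `|V T2| + (2 * L + 1) * T2.
have VT2 := ler_norm (- V T2); rewrite normrN in VT2.
have VT2' := normr_ge0 (V T2).
have T23' : T2 < T3 by rewrite /T3; nra.
have T23 := ltW T23'.
have V4 t : T3 <= t -> 2 * L * t <= V t.
  move=> T3t; have := Vbig t (le_trans T23 T3t); rewrite /T3 in T3t.
  by nra.
have Yneg t : T3 <= t -> V t <= 2 * - (Y t - Y a).
  move=> T3t; have := V4 _ T3t; have T2t := le_trans T23 T3t.
  have t0 : 0 < t by lra.
  have := IT2 t T2t; rewrite ltr_distlC => /andP[].
  set r := t^-1 * I t.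
  have IE : I t = r * t by rewrite /r mulrC mulVKf// gt_eqF.
  rewrite (YE t) ?IE; last by lra.
  have yaa := ler_norm (- Y a); rewrite normrN in yaa => r1 r2.
  have : (c - r + 1) * t <= L * t by rewrite ler_wpM2r ?(ltW t0)// /L; lra.
  nra.
have V2W t : T3 <= t -> V t ^+ 2 <= 4 * t * W t.
  move=> T3t; have at_ : a < t by lra.
  (* this [k] is the mean of [y], for which Cauchy-Schwarz is optimal *)
  have := @integral_cauchy_schwarz R a y Y W dY dW ((Y t - Y a) / (t - a)) t (ltW at_).
  set k := _ / _ => cs.
  have kE : Y t - Y a = k * (t - a) by rewrite /k divfK// gt_eqF// subr_gt0.
  rewrite Wa subr0 kE in cs; have := Yneg _ T3t; rewrite kE => Vk.
  have V0 := le_trans _ (V4 _ T3t); have {}V0 : 0 <= V t by apply: V0; nra.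
  have : V t ^+ 2 <= (2 * - (k * (t - a))) ^+ 2 by rewrite lerXn2r ?nnegrE// (le_trans V0).
  have W0 : k ^+ 2 * (t - a) <= W t by nra.
  nra.
have Vpos t : T3 <= t -> 0 < V t by move=> /[dup] T3t /V4; apply: lt_le_trans; nra.
have dec t : T3 <= t -> (V t)^-1 + ln t / 4 <= (V T3)^-1 + ln T3 / 4.
  move=> T3t.
  have := @le_of_derive_le R T3 (fun s => (V s)^-1 + 4^-1 * ln s) (fun s => - (V s) ^- 2 * W s + 4^-1 * s^-1)
     (cst 0) (fun=> 0) _ _ _ T3 t (lexx _) T3t.
  move=> h; have : (V t)^-1 + 4^-1 * ln t - ((V T3)^-1 + 4^-1 * ln T3) <= 0 - 0; last by lra.
  apply: h => s T3s.
  - have s0 : 0 < s by lra.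
    have := dV s; move=> /(_ ltac:(lra)) dVs.
    have Vs := Vpos _ T3s.
    have dVi := @is_deriveV _ V s _ 1 (lt0r_neq0 Vs) dVs.
    exact: (is_deriveD dVi (is_deriveZ 4^-1 (is_derive1_ln s0))).
  - have s0 : 0 < s by lra.
    have Vs := Vpos _ T3s; have := V2W _ T3s.
    move=> h4; have : (4 * s)^-1 <= W s / V s ^+ 2.
      by rewrite ler_pdivlMr ?exprn_gt0// ler_pdivrMl ?mulr_gt0.
    by rewrite invfM mulNr [W s / _]mulrC; lra.
(* a time at which [ln t / 4] alone exceeds the value at [T3] *)
pose t := expR (Num.max (ln T3) (4 * ((V T3)^-1 + ln T3 / 4))).
have T30 : 0 < T3 by lra.
have T3t : T3 <= t by rewrite -[leLHS]lnK ?posrE// ler_expR le_max lexx.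
have := dec _ T3t; have := Vpos _ T3t; rewrite -invr_gt0.
have : 4 * ((V T3)^-1 + ln T3 / 4) <= ln t by rewrite /t expRK le_max lexx orbT.
lra.
Qed.

(** The quantity [lambda t - I t] is [Y - U], where [U] is a primitive of the
    tail [w - W] of the integral of [y^2]. The constant [1/4] comes from
    [y - t y^2 <= 1 / (4 t)]. *)
Lemma riccati_deficit_bound (R : realType) (a c lambda : R)
    (I V W y Y : R -> R) :
  0 < a ->
  t^-1 * I t @[t --> +oo] --> lambda ->
  (forall t, a <= t -> is_derive t 1 Y (y t)) ->
  (forall t, a <= t -> is_derive t 1 V (W t)) ->
  (forall t, a <= t -> is_derive t 1 W (y t ^+ 2)) ->
  W a = 0 ->
  (forall t, a <= t -> Y t = c * t - I t - V t) ->
  exists K, forall t, a <= t -> lambda * t - I t <= ln t / 4 + K.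
Proof.
move=> a0 Icvg dY dV dW Wa YE.
have [w0 Ww0] := @riccati_square_bounded R a c lambda I V W y Y a0 Icvg dY dV dW Wa YE.
have Wmono : forall u v, a <= u -> u <= v -> W u <= W v.
  by apply: (@nondecreasing_of_derive_ge0 _ _ _ _ dW) => t _; exact: sqr_ge0.
pose w := sup (W @` `[a, +oo[).
have hsW : has_sup (W @` `[a, +oo[).
  split; first by exists (W a), a => //=; rewrite in_itv/= lexx.
  by exists w0 => _ [t /= + <-]; rewrite in_itv/= andbT => /Ww0.
have Ww t : a <= t -> W t <= w.
  by move=> at_; apply: sup_upper_bound => //; exists t => //=; rewrite in_itv/= at_.
have w_ge0 : 0 <= w by rewrite -Wa Ww.
pose U (t : R) : R := w * t - V t.
have dU t : a <= t -> is_derive t 1 U (w - W t).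
  move=> /dV dVt; exact: (is_derive_eq (is_deriveB (is_deriveZ w (is_derive_id t 1)) dVt)
    (congr1 (fun x => x - _) (mulr1 _))).
have Ubnd e : 0 < e -> exists2 T, a <= T & forall t, T <= t -> 0 <= U t - U T <= e * (t - T).
  move=> e0; have [_ [T /= + <-] wT] := sup_adherent e0 hsW.
  rewrite in_itv/= andbT => aT; exists T => // t Tt.
  have dU' s : T <= s -> is_derive s 1 U (w - W s) by move=> Ts; apply: dU; lra.
  apply/andP; split.
    rewrite subr_ge0; apply: (@nondecreasing_of_derive_ge0 R T _ _ dU') => // s Ts.
    by rewrite subr_ge0 Ww//; lra.
  have := @le_of_derive_le R T U (fun s => w - W s) (fun s => e * s) (fun=> e) dU'
    _ _ T t (lexx _) Tt.
  move=> h; have : U t - U T <= e * t - e * T; last by lra.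
  apply: h => s Ts.
    exact: (is_derive_eq (is_deriveZ e (is_derive_id s 1)) (mulr1 _)).
  by have := Wmono _ _ aT Ts; rewrite -/w in wT; lra.
have Ybnd e t : 0 < e -> a <= t -> `|Y t - Y a| <= w / (2 * e) + e * t / 2.
  move=> e0 at_; have cs k := @integral_cauchy_schwarz R a y Y W dY dW k t at_.
  (* [k := e] bounds the difference from above, [k := - e] from below *)
  have := Ww t at_; rewrite Wa in cs => Wtw.
  have ewE : w = 2 * e * (w / (2 * e)) by rewrite mulrC divfK// gt_eqF// mulr_gt0.
  rewrite ler_norml; apply/andP; split; rewrite -(@ler_pM2l _ (2 * e)) ?mulr_gt0// mulrDr -?ewE ?mulrN ?mulrDr -?ewE.
    by have := cs (- e); nra.
  by have := cs e; nra.
(* [(c - w - lambda) t] is a sum of terms that are [o(t)] *)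
have cE : c - w = lambda.
  apply/eqP; rewrite -subr_eq0 -normr_le0; apply/ler_addgt0Pr => e e0; rewrite add0r.
  pose d := e / 4; have d0 : 0 < d by rewrite divr_gt0.
  have [T1 aT1 UT] := Ubnd d d0.
  have [T2 T12 IT] := near_pinfty_ge R T1 _ (proj1 (cvgrPdist_lt _ _) Icvg d d0).
  pose N := `|U T1| + `|Y a| + w / (2 * d).
  pose t := T2 + N / d.
  have N0 : 0 <= N by rewrite !addr_ge0// divr_ge0// mulr_ge0// ltW.
  have dt : N <= d * t.
    rewrite /t mulrDr [d * (N / d)]mulrC divfK ?gt_eqF// lerDr mulr_ge0 ?(ltW d0)//.
    by lra.
  have T2t : T2 <= t by rewrite lerDl divr_ge0// ltW.
  have t0 : 0 < t by lra.
  have := IT t T2t; set r := t^-1 * I t.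
  have IE : I t = r * t by rewrite /r mulrC mulVKf// gt_eqF.
  rewrite distrC => /ltW r1.
  have at_ : a <= t by lra.
  have Y1 := Ybnd d t d0 at_.
  have /UT /andP[U1 U2] : T1 <= t by lra.
  rewrite -(ler_pM2r t0) -{1}(gtr0_norm t0) -normrM.
  have -> : (c - w - lambda) * t = (Y t - Y a) - (U t - U T1) + (r - lambda) * t + (Y a - U T1).
    by rewrite (YE t at_) IE /U; ring.
  rewrite (le_trans (ler_normD _ _))// (_ : e = d + d + d + d); last by rewrite /d; field.
  have rt : `|(r - lambda) * t| <= d * t.
    by rewrite normrM (gtr0_norm t0) ler_wpM2r// ltW.
  have UU : `|U t - U T1| <= d * t by rewrite ger0_norm//; nra.
  have := ler_normD (Y t - Y a - (U t - U T1)) ((r - lambda) * t).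
  have := ler_normB (Y t - Y a) (U t - U T1).
  have := ler_normB (Y a) (U T1).
  rewrite /N in dt; nra.
(* [- G' = t (y - 1 / (2 t))^2]: the term [t (w - W)] compensates for [U] *)
pose G (t : R) : R := Y t - U t + t * (w - W t) - 4^-1 * ln t.
exists (G a) => t at_.
have t0 : 0 < t by lra.
have -> : lambda * t - I t = Y t - U t by rewrite (YE t at_) -cE /U; ring.
have : 0 <= t * (w - W t) by rewrite mulr_ge0 ?subr_ge0 ?Ww// ltW.
suff : G t <= G a by rewrite {1}/G; lra.
have dNG s : a <= s -> is_derive s 1 (fun s => - G s) (s * (y s - (2 * s)^-1) ^+ 2).
  move=> as_; have s0 : 0 < s by lra.
  have dWs := dW s as_.
  have d1 : is_derive s 1 (fun s => w - W s) (0 - y s ^+ 2) := is_deriveB (is_derive_cst w s 1) dWs.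
  have d2 := is_deriveM (is_derive_id s 1) d1.
  have d3 := is_deriveZ 4^-1 (is_derive1_ln s0).
  apply: (is_derive_eq (is_deriveN (is_deriveB (is_deriveD (is_deriveB (dY s as_) (dU s as_)) d2) d3))).
  rewrite /GRing.scale/=; field; exact: lt0r_neq0.
rewrite -lerN2; apply: (@nondecreasing_of_derive_ge0 R a _ _ dNG) => // s as_.
by rewrite mulr_ge0 ?sqr_ge0//; lra.
Qed.

(** * Absolutely continuous functions with zero derivative almost everywhere *)

Lemma is_derive_ball (R : realType) (f : R -> R) (x l e : R) :
  is_derive x 1 f l -> 0 < e ->
  exists2 r, 0 < r &
    forall z, `|z - x| < r -> `|f z - f x - l * (z - x)| <= e * `|z - x|.
Proof.
move=> [dx dl] e0.
have : s^-1 *: (f (s *: 1 + x) - f x) @[s --> 0^'] --> l by rewrite -dl; exact: dx.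
move=> /cvgrPdist_le /(_ e e0) [r /= r0 hr]; exists r => // z zr.
have [->|zx] := eqVneq z x; first by rewrite !subrr mulr0 subr0 normr0 mulr0.
have zx0 : z - x != 0 by rewrite subr_eq0.
have := hr (z - x); rewrite /= sub0r normrN => /(_ zr zx0).
rewrite [_ *: 1]mulr1 subrK /GRing.scale/= => hz.
have -> : f z - f x - l * (z - x) = - ((l - (z - x)^-1 * (f z - f x)) * (z - x)).
  by field.
by rewrite normrN normrM ler_wpM2r.
Qed.

Lemma is_derivative_from_is_derive (R : realType) (t0 t l : R) (f : R -> R) :
  t0 < t -> is_derivative_from t0 f t l -> is_derive t 1 f l.
Proof.
move=> t0t dl.
suff d : s^-1 *: (f (s *: 1 + t) - f t) @[s --> 0^'] --> l.
  by apply: DeriveDef; [apply/cvg_ex; exists l|exact/cvg_lim].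
apply/cvgrPdist_lt => e e0.
move/cvgrPdist_lt : dl => /(_ e e0) [r /= r0 hr].
exists (Num.min r (t - t0)) => /=; first by rewrite lt_min r0 subr_gt0.
move=> s; rewrite /= sub0r normrN lt_min => /andP[sr st] s0.
have := hr (s + t); rewrite /= opprD addrCA subrr addr0 normrN => /(_ sr).
rewrite [_ *: 1]mulr1 addrK /GRing.scale/= [X in l - X]mulrC; apply.
  by rewrite -subr_eq0 addrK.
by rewrite in_itv/= andbT; have := ler_norm (- s); rewrite normrN; lra.
Qed.

(** Induction along a segment, in place of a tagged partition subordinate to
    the gauge [d] (Cousin's lemma): at the supremum [c] of the points reached,
    the step passes from a point just before [c] to one beyond it. *)
Lemma real_induction (R : realType) (a b : R) (S : R -> Prop) :
  a <= b -> S a ->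
  (forall x, a <= x -> x <= b -> exists2 d, 0 < d & forall u v,
     a <= u -> u <= x -> x <= v -> v <= b -> x - d < u -> v < x + d ->
     S u -> S v) ->
  S b.
Proof.
move=> ab Sa step.
pose A := [set x | [/\ a <= x, x <= b & S x]].
have hsA : has_sup A.
  by split; [exists a; split|exists b => x []].
have ac : a <= sup A by apply: sup_upper_bound => //; split.
have cb : sup A <= b by apply: ge_sup; [exists a; split|move=> x []].
have [d d0 stepc] := step _ ac cb.
have [u [au ub Su] cu] := sup_adherent d0 hsA.
have uc : u <= sup A by apply: sup_upper_bound.
have [cdb|bcd] := leP (sup A + d / 2) b; last first.
  apply: (stepc u b) => //; apply: (lt_le_trans bcd).
  by rewrite lerD2l ler_pdivrMr// ler_pMr// ler1n.
have Acd : A (sup A + d / 2).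
  split => //; first by lra.
  by apply: (stepc u) => //; lra.
have := sup_upper_bound hsA Acd; lra.
Qed.

(** Cover the exceptional null set by an open set [G] of small measure. Near any
    other point [h] varies by at most [e] times the length; around an
    exceptional point, a small interval is contained in [G]. Going from [a] to [b] by
    [real_induction], the intervals of the second kind are collected in a
    list of total length at most the measure of [G], so that absolute
    continuity bounds the variation of [h] on them. *)
Lemma ac_derive0_ae_eq (R : realType) (a b : R) (h : R -> R) :
  a <= b -> absolutely_continuous_on a b h ->
  {ae @lebesgue_measure R, forall x, a < x -> x < b -> is_derive x 1 h 0} ->
  h b = h a.
Proof.
move=> ab ach dh.
apply/eqP; rewrite -subr_eq0 -normr_le0; apply/ler_addgt0Pr => e0 e00; rewrite add0r.
(* the exceptional intervals contribute [e], the others [e * (b - a)] *)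
pose e := e0 / (1 + (b - a)).
have e_gt0 : 0 < e by rewrite divr_gt0//; lra.
have [d d0 hd] := ach e e_gt0.
have negl1 (x : R) : lebesgue_measure.-negligible [set x].
  by apply/negligibleP; [exact: measurable_set1|exact: lebesgue_measure_set1].
(* the endpoints count as exceptional: nothing is known of the derivative there *)
have [Z [mZ muZ0 dhZ]] : lebesgue_measure.-negligible
    (~` [set x | a < x -> x < b -> is_derive x 1 h 0] `|` ([set a] `|` [set b])).
  by apply: negligibleU => //; exact: negligibleU.
have [|G [openG ZG muG]] := @lebesgue_regularity_outer R Z d mZ _ d0.
  by rewrite [ltLHS]muZ0.
have mG : measurable G by exact: open_measurable.
have {}muG : (lebesgue_measure G < d%:E)%E.
  rewrite -(setDUK ZG) measureU//; last 2 first.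
    exact: measurableD.
    by rewrite setDE setICA setICr setI0.
  by rewrite [X in (X + _)%E]muZ0 add0e.
pose m (x : R) : R := fine (lebesgue_measure (G `&` `[a, x])).
have finI A : measurable A -> lebesgue_measure (G `&` A) \is a fin_num.
  move=> mA; rewrite ge0_fin_numE//; apply: le_lt_trans (lt_trans muG (ltry d)).
  by apply: le_measure; rewrite ?inE//; exact: measurableI.
have mD u v : a <= u -> u <= v -> `]u, v] `<=` G -> m v = m u + (v - u).
  move=> au uv uvG; rewrite /m.
  have -> : G `&` `[a, v] = (G `&` `[a, u]) `|` `]u, v].
    rewrite -[X in _ `|` X](setIidr uvG) -setIUr -itv_bndbnd_setU//.
  rewrite measureU//=; last 2 first.
    exact: measurableI.
    apply/seteqP; split => // x /= [[_]]; rewrite !in_itv/= => /andP[_ xu] /andP[].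
    by rewrite ltNge xu.
  have -> : lebesgue_measure `]u, v]%classic = (v - u)%:E.
    rewrite lebesgue_measure_itv/= lte_fin; case: ltP => [_|vu]; first by rewrite -EFinB.
    by have -> : v = u; [apply/le_anti; rewrite vu uv|rewrite subrr].
  by rewrite fineD// finI.
(* [s] lists the intervals around exceptional points met before [x]; its length is
   paid for by the part of [G] on the left of [x] *)
pose S x := exists s : seq (R * R),
  [/\ all (fun p => (a <= p.1) && (p.1 <= p.2) && (p.2 <= x)) s,
      pairwise (fun p r => (p.2 <= r.1) || (r.2 <= p.1)) s,
      \sum_(p <- s) (p.2 - p.1) <= m x &
      `|h x - h a| <= \sum_(p <- s) `|h p.2 - h p.1| + e * (x - a)].
have mono u v : a <= u -> u <= v -> m u <= m v.
  move=> au uv; rewrite /m fine_le ?finI//.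
  apply: le_measure; rewrite ?inE; [exact: measurableI..|].
  apply: setIS; apply: subset_itvl; exact: uv.
have [s [sab spw sm hs]] : S b.
  apply: (real_induction R a b S ab).
    exists [::]; split => //; rewrite big_nil.
    - by rewrite fine_ge0.
    - by rewrite !subrr normr0 mulr0 addr0.
  move=> x ax xb; have [Zx|nZx] := pselect (Z x).
    have /nbhs_ballP[r /= r0 rG] : nbhs x G by apply: open_nbhs_nbhs; split => //; exact: ZG.
    exists r => // u v au ux xv vb xru vxr [s [s1 s2 s3 s4]].
    have uv : u <= v := le_trans ux xv.
    exists (rcons s (u, v)); split.
    - rewrite all_rcons/= au uv lexx/=; apply: sub_all s1 => p.
      by move=> /andP[->] /le_trans->.
    - rewrite pairwise_rcons s2 andbT.
      by apply: sub_all s1 => p /andP[_] /= ->.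
    - rewrite big_rcons/= (mD u v)// ?lerD//.
      move=> z /=; rewrite in_itv/= => /andP[uz zv]; apply: rG.
      by rewrite /ball/= ltr_distlC; apply/andP; split; lra.
    - rewrite big_rcons/=.
      have := ler_normD (h v - h u) (h u - h a); rewrite addrA subrK.
      have : e * (u - a) <= e * (v - a) by rewrite ler_pM2l//; lra.
      by move: s4; lra.
  have {nZx} [ax' xb' dhx] : [/\ a < x, x < b & is_derive x 1 h 0].
    have nE : ~ (~` [set x | a < x -> x < b -> is_derive x 1 h 0] `|`
         ([set a] `|` [set b])) x by move=> /dhZ.
    have ax' : a < x.
      by rewrite lt_neqAle ax andbT; apply/eqP => ax'; apply: nE; right; left.
    have xb' : x < b.
      by rewrite lt_neqAle xb andbT; apply/eqP => ax''; apply: nE; right; right.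
    split => //; apply: contrapT => nd; apply: nE; left => /= /(_ ax' xb') //.
  have [r r0 rh] : exists2 r, 0 < r & forall z, `|z - x| < r -> `|h z - h x| <= e * `|z - x|.
    have [r r0 hr] := @is_derive_ball R h x 0 e dhx e_gt0.
    by exists r => // z /hr; rewrite mul0r subr0.
  exists r => // u v au ux xv vb xru vxr [s [s1 s2 s3 s4]].
  have uv : u <= v := le_trans ux xv.
  exists s; split => //.
  - apply: sub_all s1 => p /andP[-> /=] /le_trans; exact.
  - exact: le_trans s3 (mono _ _ au uv).
  - have := rh u; rewrite ler0_norm ?subr_le0// => /(_ ltac:(lra)).
    have := rh v; rewrite ger0_norm ?subr_ge0// => /(_ ltac:(lra)).
    have := ler_normD (h v - h x) (h x - h u).
    have := ler_normD (h v - h u) (h u - h a).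
    rewrite [`|h u - h x|]distrC !addrA !subrK.
    move: s4; lra.
have md : m b < d.
  rewrite -lte_fin fineK ?finI//; apply: le_lt_trans muG.
  by apply: le_measure; rewrite ?inE//; exact: measurableI.
have := hd s sab spw (le_lt_trans sm md).
have -> : e0 = e + e * (b - a) by rewrite /e; field; lra.
lra.
Qed.

(** * Completed Lebesgue measure and Borel functions *)

Lemma borel_completed_measurable (R : realType) (A : set R) :
  measurable (A : set (measurableTypeR R)) ->
  measurable (A : set (caratheodory_type (@wlength R idfun)^*%mu)).
Proof. exact: sub_caratheodory. Qed.

Lemma measurable_id_completed (R : realType) :
  measurable_fun setT
    (idfun : caratheodory_type (@wlength R idfun)^*%mu -> measurableTypeR R).
Proof. by move=> _ A mA; rewrite setTI; exact: borel_completed_measurable. Qed.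

(** Both measures are restrictions of the same outer measure, so Lebesgue
    measure is the image of its completion under the identity. *)
Lemma ge0_integral_completed (R : realType) (D : set R) (f : R -> \bar R) :
  measurable (D : set (measurableTypeR R)) ->
  measurable_fun (D : set (measurableTypeR R)) f ->
  {in D, forall x, (0 <= f x)%E} ->
  (\int[@completed_lebesgue_measure R]_(x in D) f x =
   \int[@lebesgue_measure R]_(x in D) f x)%E.
Proof.
move=> mD mf f0.
have <- := @ge0_integral_pushforward _ _ _ (measurableTypeR R) _ _ (@measurable_id_completed R)
  (@completed_lebesgue_measure R) D f mD mf f0.
by apply: eq_measure_integral => [|Hyp A mA _]; first exact: measurable_id_completed.
Qed.

Lemma integral_completed (R : realType) (D : set R) (f : R -> \bar R) :
  measurable (D : set (measurableTypeR R)) ->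
  measurable_fun (D : set (measurableTypeR R)) f ->
  (\int[@completed_lebesgue_measure R]_(x in D) f x =
   \int[@lebesgue_measure R]_(x in D) f x)%E.
Proof.
move=> mD mf; rewrite integralE [RHS]integralE; congr (_ - _)%E.
  by apply: ge0_integral_completed => //; exact: measurable_funepos.
by apply: ge0_integral_completed => //; exact: measurable_funeneg.
Qed.

(** A completed measurable set is the union of a Borel set and a negligible
    one; if it is null, so is its Borel part. *)
Lemma completed_negligible (R : realType) (N : set R) :
  (@completed_lebesgue_measure R).-negligible N ->
  (@lebesgue_measure R).-negligible N.
Proof.
move=> [A [mA A0 NA]]; apply: (@negligibleS _ (measurableTypeR R) R (@lebesgue_measure R) A N NA).
move: (mA); rewrite -[X in X A]completed_caratheodory_measurable g_sigma_completed_algebra_genE.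
move=> [B mB [N' negN'] BN'A]; rewrite -BN'A; apply: negligibleU => //.
apply/negligibleP => //; apply/eqP; rewrite eq_le measure_ge0 andbT.
have BA : B `<=` A by rewrite -BN'A; exact: subsetUl.
have : (@completed_lebesgue_measure R B <= @completed_lebesgue_measure R A)%E.
  by apply: le_measure; rewrite ?inE//; exact: borel_completed_measurable.
by rewrite A0.
Qed.

(** For each rational [r], the set where [r < g] is a Borel set up to a null
    set. The supremum of the rationals [r] whose Borel set contains [x] is a
    Borel function of [x], equal to [g x] outside countably many null sets. *)
Lemma completed_measurable_borel (R : realType) (g : R -> R) :
  measurable_fun (setT : set (caratheodory_type (@wlength R idfun)^*%mu)) g ->
  exists2 f : R -> R, measurable_fun (setT : set (measurableTypeR R)) f &
    {ae @lebesgue_measure R, forall x, f x = g x}.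
Proof.
move=> mg.
pose r (n : nat) : R := if @unpickle rat n is Some p then ratr p else 0.
have BN n : exists B, measurable (B : set (measurableTypeR R)) /\
    exists2 N, (@lebesgue_measure R).-negligible N & g @^-1` `]r n, +oo[ = B `|` N.
  have : measurable (g @^-1` `]r n, +oo[ : set (caratheodory_type (@wlength R idfun)^*%mu)).
    by rewrite -[X in measurable X]setTI; apply: mg.
  rewrite -[X in X _]completed_caratheodory_measurable g_sigma_completed_algebra_genE.
  by move=> [B mB [N negN] BN]; exists B; split => //; exists N.
have [B hB] := choice BN.
pose h n x : \bar R := if x \in B n then (r n)%:E else -oo%E.
pose F x := esups (h ^~ x) 0%N.
have mF : measurable_fun (setT : set (measurableTypeR R)) F.
  apply: (@measurable_fun_esups _ (measurableTypeR R) R setT h) => n.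
  have [mB _] := hB n.
  apply: measurable_fun_ifT => //.
  apply: (@measurable_fun_bool _ _ _ _ true); rewrite setTI.
  by rewrite [X in measurable X](_ : _ = B n)//; apply/seteqP; split => x; [exact: set_mem|exact: mem_set].
exists (fine \o F).
  by apply: measurableT_comp => //; exact: fine_measurable.
have : (@lebesgue_measure R).-negligible (\bigcup_n ((g @^-1` `]r n, +oo[) `\` B n)).
  apply: negligible_bigcup => n; have [_ [N negN ->]] := hB n.
  by apply: negligibleS negN => x [[]].
apply: negligibleS => x /= Fgx; apply: contrapT => nx; apply: Fgx.
have Bx n : (x \in B n) = (r n < g x).
  apply/idP/idP => [/set_mem Bnx|rx].
    have : (g @^-1` `]r n, +oo[) x by have [_ [N _ ->]] := hB n; left.
    by rewrite /= in_itv/= andbT.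
  by apply/mem_set; apply: contrapT => nB; apply: nx; exists n => //; split => //=; rewrite in_itv/= rx.
suff -> : F x = (g x)%:E by [].
apply/eqP; rewrite eq_le; apply/andP; split.
  apply: ge_ereal_sup => _ [n _ <-]; rewrite /h Bx.
  by case: ifPn => // rg; rewrite ?leNye// lee_fin ltW.
apply/lee_subgt0Pr => e e0.
have [p] := rat_in_itvoo (ltac:(lra) : g x - e < g x).
rewrite in_itv/= => /andP[p1 p2].
have rp : r (pickle p) = ratr p by rewrite /r pickleK.
apply: (@le_trans _ _ (h (pickle p) x)).
  by rewrite /h Bx rp p2 lee_fin ltW.
by apply: ereal_sup_ubound; exists (pickle p).
Qed.

Lemma borel_completed_measurable_fun (R : realType) d (T : measurableType d)
    (D : set R) (h : R -> T) :
  measurable (D : set (measurableTypeR R)) ->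
  measurable_fun (D : set (measurableTypeR R)) h ->
  measurable_fun (D : set (caratheodory_type (@wlength R idfun)^*%mu)) h.
Proof. by move=> mD mh _ B mB; apply: borel_completed_measurable; exact: mh. Qed.

(** The Borel function is taken to be zero on the left of [t0]: the integrals
    can then run over [(-oo, T]], and their primitive is defined, and
    differentiable almost everywhere, on the whole line. *)
Lemma locally_integrable_representative (R : realType) (t0 : R) (q : R -> R) :
  locally_integrable_from t0 q ->
  exists f : R -> R,
  [/\ measurable_fun (setT : set (measurableTypeR R)) f,
      (forall T, (@lebesgue_measure R).-integrable `]-oo, T] (EFin \o f)),
      {ae @lebesgue_measure R, forall x, t0 <= x -> f x = q x} &
      (forall T, \int[@completed_lebesgue_measure R]_(s in `[t0, T]) q s =
         \int[@lebesgue_measure R]_(s in `]-oo, T]) f s)].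
Proof.
move=> hq.
pose C := caratheodory_type (@wlength R idfun)^*%mu.
have mitv (i : interval R) : measurable ([set` i] : set C).
  by apply: borel_completed_measurable; exact: measurable_itv.
have mq : measurable_fun (`[t0, +oo[ : set C) q.
  have -> : `[t0, +oo[%classic = \bigcup_n `[t0, t0 + n%:R]%classic :> set C.
    apply/seteqP; split => x /=.
      rewrite in_itv/= andbT => tx; exists (Num.truncn (x - t0)).+1 => //=.
      by rewrite in_itv/= tx/= -lerBlDl ltW// truncnS_gt.
    by move=> [n _] /=; rewrite !in_itv/= => /andP[->].
  apply/measurable_fun_bigcup => [n|n]; first exact: mitv.
  have /integrableP[/measurable_EFinP + _] := hq (t0 + n%:R) ltac:(by rewrite lerDl).
  exact.
pose g := q \_ `[t0, +oo[.
have mg : measurable_fun (setT : set C) g.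
  by apply/(measurable_restrictT _ _).1 => //; exact: mitv.
have [f0 mf0 f0g] := completed_measurable_borel R g mg.
pose f := f0 \_ `[t0, +oo[.
have mf : measurable_fun (setT : set (measurableTypeR R)) f.
  by apply/(measurable_restrictT _ _).1 => //; exact: measurable_funTS.
have fq : {ae @lebesgue_measure R, forall x, t0 <= x -> f x = q x}.
  move: f0g; apply: filterS; first exact: (ae_filter_ringOfSetsType (@lebesgue_measure R)).
  move=> x fgx t0x.
  have xt : x \in `[t0, +oo[%classic by rewrite inE/= in_itv/= t0x.
  by rewrite /f patchE xt fgx /g patchE xt.
(* [k] is the inclusion for the integrals and the norm for integrability *)
have patch_half (k : R -> \bar R) T : k 0 = 0%E ->
    (k \o f) \_ `]-oo, T] = (k \o f) \_ `[t0, T].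
  move=> k0; apply/funext => x; rewrite !patchE /=.
  have [t0x|xt0] := leP t0 x.
    by rewrite !mem_setE !in_itv/= t0x.
  have -> : f x = 0 by rewrite /f patchE memNset//= in_itv/= leNgt xt0.
  by rewrite k0; case: ifP; case: ifP.
have intqf (k : R -> \bar R) T : k 0 = 0%E -> measurable_fun setT k ->
    (\int[@completed_lebesgue_measure R]_(s in `[t0, T]) k (q s) =
     \int[@lebesgue_measure R]_(s in `]-oo, T]) k (f s))%E.
  move=> k0 mk.
  have mkf : measurable_fun (setT : set (measurableTypeR R)) (k \o f).
    exact: measurableT_comp.
  rewrite [RHS]integral_mkcond patch_half// -integral_mkcond.
  rewrite -integral_completed//; last exact: measurable_funTS.
  apply: ae_eq_integral.
  - exact: mitv.
  - apply: (@measurableT_comp _ _ _ C) => //; apply: measurable_funS mq; first exact: mitv.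
    by move=> x /=; rewrite !in_itv/= => /andP[->].
  - by apply: borel_completed_measurable_fun => //; exact: measurable_funTS.
  - case: fq => A [mA A0 fA]; exists A; split => //.
      exact: borel_completed_measurable.
    move=> x nx; apply: fA => fqx; apply: nx => /=; rewrite in_itv/= => /andP[/fqx -> _] //.
exists f; split => //; last first.
  by move=> T; rewrite /Rintegral (intqf EFin)//; exact: EFin_measurable.
move=> T; apply/integrableP; split.
  by apply/measurable_EFinP; exact: measurable_funTS.
have mabs : measurable_fun setT (fun x : R => `|x%:E|%E).
  by apply: measurableT_comp => //; exact: EFin_measurable.
rewrite -(intqf (fun x => `|x%:E|%E) T) ?abse0//.
have [t0T|Tt0] := leP t0 T; last first.
  by rewrite set_itv_ge ?integral_set0// bnd_simp -ltNge.
by have /integrableP[] := hq _ t0T.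
Qed.

(** * Primitives of integrable functions *)

(** The increments over disjoint intervals add up to at most the integral of
    the norm of [f] over their union, which is small with its measure. *)
Lemma absolutely_continuous_integral (R : realType) (f : R -> R) (a b : R) :
  (@lebesgue_measure R).-integrable `]-oo, b] (EFin \o f) ->
  absolutely_continuous_on a b
    (fun x => \int[@lebesgue_measure R]_(s in `]-oo, x]) f s).
Proof.
pose P x := \int[@lebesgue_measure R]_(s in `]-oo, x]) f s.
rewrite -/P => intf e e0.
pose g := f \_ `]-oo, b].
have intg : (@lebesgue_measure R).-integrable setT (EFin \o g).
  by rewrite -restrict_EFin; apply/integrable_restrict => //=; rewrite setTI.
have intng A : measurable A -> (@lebesgue_measure R).-integrable A (EFin \o (fun x => `|g x|)).
  move=> mA; apply: integrableS (integrable_norm intg) => //.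
have [d [d0 gd]] := integral_normr_continuous intg e0.
have incr u v : u <= v -> v <= b ->
    `|P v - P u| <= \int[@lebesgue_measure R]_(x in `]u, v]) `|g x|.
  move=> uv vb.
  have PB : P v - P u = \int[@lebesgue_measure R]_(x in `]u, v]) f x.
    rewrite /P Rintegral_itvB//; first by apply: integrableS intf => //; exact: subset_itvl.
  rewrite PB; apply: le_trans (le_normr_Rintegral _ _) _ => //.
    apply: integrableS intf => // x /=; rewrite !in_itv/= => /andP[_] /le_trans; exact.
  rewrite le_eqVlt; apply/orP; left; apply/eqP; apply: eq_Rintegral => x.
  rewrite inE/= in_itv/= => /andP[_ xv].
  by rewrite /g patchE mem_set//= in_itv/= (le_trans xv).
have key s : all (fun p => (a <= p.1) && (p.1 <= p.2) && (p.2 <= b)) s ->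
    pairwise (fun p r => (p.2 <= r.1) || (r.2 <= p.1)) s ->
    let A := \big[setU/set0]_(p <- s) `]p.1, p.2]%classic in
    [/\ measurable A, @lebesgue_measure R A = (\sum_(p <- s) (p.2 - p.1))%:E &
      \sum_(p <- s) `|P p.2 - P p.1| <= \int[@lebesgue_measure R]_(x in A) `|g x|].
  elim: s => [_ _|p s IH].
    by rewrite /= !big_nil; split => //; rewrite ?measure0// Rintegral_set0.
  move=> /= /andP[/andP[/andP[ap p12] pb] sab] /andP[ps ss].
  have [mA muA hA] := IH sab ss.
  rewrite !big_cons; set A := \big[_/_]_(_ <- s) _ in mA muA hA *.
  have disj : `]p.1, p.2]%classic `&` A = set0.
    apply/seteqP; split => // x /= [xp]; rewrite /A -bigcup_seq => -[r /= rs xr].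
    move: ps => /allP /(_ _ rs); move: xp xr; rewrite /= !in_itv/= => /andP[x1 x2] /andP[x3 x4].
    by case/orP; lra.
  have mpA : measurable (`]p.1, p.2]%classic `|` A) by exact: measurableU.
  split => //.
    rewrite measureU// EFinD; congr (_ + _)%E; last exact: muA.
    apply: (etrans (lebesgue_measure_itv _)); rewrite /= lte_fin.
    case: ltP => [_|vu]; first by rewrite -EFinB.
    by have -> : p.2 = p.1; [apply/le_anti; rewrite vu p12|rewrite subrr].
  rewrite Rintegral_setU//; [|exact: intng|exact/disj_set2P].
  by rewrite lerD// incr.
exists d => // s sab ss sd.
have [mA muA hA] := key s sab ss.
by apply: le_lt_trans hA (gd _ mA _); rewrite [ltLHS]muA lte_fin.
Qed.

Lemma ae_is_derive_integral (R : realType) (f : R -> R) :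
  measurable_fun (setT : set (measurableTypeR R)) f ->
  (forall T, (@lebesgue_measure R).-integrable `]-oo, T] (EFin \o f)) ->
  {ae @lebesgue_measure R, forall x : R,
    is_derive x 1 (fun x : R => \int[@lebesgue_measure R]_(s in `]-oo, x]) f s) (f x)}.
Proof.
move=> mf intf.
have locf : locally_integrable [set: R] f.
  split => //; first exact: openT.
  move=> K _ cK; have [M [_ /(_ (M + 1))]] := compact_bounded cK.
  rewrite ltrDl ltr01 => /(_ isT) KM.
  apply: le_lt_trans (integrableP _ _ _ (intf (M + 1))).2.
  apply: ge0_subset_integral => //.
  - exact: compact_measurable.
  - by apply/measurable_EFinP; apply: measurable_funTS; exact: measurableT_comp.
  - move=> x Kx; rewrite /= in_itv/=; exact: le_trans (ler_norm _) (KM _ Kx).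
move: (FTC1Ny intf locf); apply: filterS; first exact: (ae_filter_ringOfSetsType (@lebesgue_measure R)).
move=> x /= [dx dxE]; apply: DeriveDef; first exact: dx.
by rewrite -derive1E; exact: dxE.
Qed.

Lemma absolutely_continuous_on_continuous (R : realType) (a b x : R) (f : R -> R) :
  absolutely_continuous_on a b f -> a < x -> x < b -> {for x, continuous f}.
Proof.
move=> acf ax xb; apply/cvgrPdist_lt => e e0; have [d d0 fd] := acf e e0.
near=> y.
have yxd : `|x - y| < d by near: y; exists d.
have ay : a <= y by near: y; exact: lt_le_nbhsr.
have yb : y <= b by near: y; exact: lt_le_nbhsl.
have [xy|yx] := leP x y.
- have := fd [:: (x, y)]; rewrite !big_seq1/= (ltW ax) xy yb/= distrC; apply => //.
  by rewrite distrC ger0_norm ?subr_ge0// in yxd.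
- have := fd [:: (y, x)]; rewrite !big_seq1/= ay (ltW xb) (ltW yx)/=; apply => //.
  by rewrite ger0_norm ?subr_ge0 ?ltW// in yxd.
Unshelve. all: by end_near. Qed.

(** * Algebra of absolutely continuous functions *)

(** The common source of the closure properties of absolutely continuous
    functions below. *)
Lemma absolutely_continuous_dominated (R : realType) (a b M : R) (f g h : R -> R) :
  absolutely_continuous_on a b f -> absolutely_continuous_on a b g ->
  (forall u v, a <= u -> u <= v -> v <= b ->
    `|h v - h u| <= M * (`|f v - f u| + `|g v - g u|)) ->
  absolutely_continuous_on a b h.
Proof.
move=> acf acg hM e e0.
(* [M] is not assumed positive *)
pose N := `|M| + 1; have N0 : 0 < N by rewrite ltr_wpDl.
have e' : 0 < e / (2 * N) by rewrite divr_gt0 ?mulr_gt0.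
have [d1 d10 fd] := acf _ e'; have [d2 d20 gd] := acg _ e'.
exists (Num.min d1 d2); first by rewrite lt_min d10.
move=> s sab ss; rewrite lt_min => /andP[sd1 sd2].
have := fd s sab ss sd1; have := gd s sab ss sd2.
rewrite !ltr_pdivlMr ?mulr_gt0// => gs fs.
have : \sum_(p <- s) `|h p.2 - h p.1| <=
    N * (\sum_(p <- s) `|f p.2 - f p.1| + \sum_(p <- s) `|g p.2 - g p.1|).
  rewrite -big_split/= mulr_sumr; rewrite !big_seq; apply: ler_sum => p ps.
  have /andP[/andP[ap p12] pb] := allP sab _ ps.
  apply: le_trans (hM _ _ ap p12 pb) _; rewrite ler_wpM2r ?addr_ge0//.
  by rewrite /N; have := ler_norm M; lra.
by move: gs fs; lra.
Qed.

Lemma absolutely_continuous_id (R : realType) (a b : R) :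
  absolutely_continuous_on a b id.
Proof.
move=> e e0; exists e => // s sab _; apply: le_lt_trans.
rewrite !big_seq; apply: ler_sum => p /(allP sab) /andP[/andP[_ p12] _].
by rewrite ger0_norm ?subr_ge0.
Qed.

Lemma absolutely_continuousD (R : realType) (a b : R) (f g : R -> R) :
  absolutely_continuous_on a b f -> absolutely_continuous_on a b g ->
  absolutely_continuous_on a b (fun x => f x + g x).
Proof.
move=> acf acg; apply: (@absolutely_continuous_dominated R a b 1 f g) => //.
move=> u v _ _ _; rewrite mul1r; apply: le_trans (ler_normD _ _).
by rewrite le_eqVlt; apply/orP; left; apply/eqP; congr `|_|; ring.
Qed.

Lemma absolutely_continuousM (R : realType) (a b M : R) (f g : R -> R) :
  (forall x, a <= x -> x <= b -> `|f x| <= M /\ `|g x| <= M) ->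
  absolutely_continuous_on a b f -> absolutely_continuous_on a b g ->
  absolutely_continuous_on a b (fun x => f x * g x).
Proof.
move=> fgM acf acg; apply: (@absolutely_continuous_dominated R a b M f g) => //.
move=> u v au uv vb.
have [fu _] := fgM u au (le_trans uv vb); have [_ gv] := fgM v (le_trans au uv) vb.
have -> : f v * g v - f u * g u = (f v - f u) * g v + f u * (g v - g u) by ring.
rewrite (le_trans (ler_normD _ _))// !normrM mulrDr lerD//.
  by rewrite mulrC ler_wpM2r.
by rewrite ler_wpM2r.
Qed.

Lemma continuous_bounded_itv (R : realType) (a b : R) (f : R -> R) :
  a <= b -> (forall x, a <= x -> x <= b -> {for x, continuous f}) ->
  exists M, forall x, a <= x -> x <= b -> `|f x| <= M.
Proof.
move=> ab cf.
have [|c _ hc] := @EVT_max R (fun x => `|f x|) a b ab.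
  apply: continuous_in_subspaceT => x /set_mem; rewrite /= in_itv/= => /andP[ax xb].
  by apply: (continuous_comp (cf x ax xb)); exact: norm_continuous.
by exists `|f c| => x ax xb; apply: hc; rewrite in_itv/= ax.
Qed.

Lemma absolutely_continuous_derive (R : realType) (a b : R) (F f : R -> R) :
  a <= b -> (forall x, a <= x -> x <= b -> is_derive x 1 F (f x)) ->
  (forall x, a <= x -> x <= b -> {for x, continuous f}) ->
  absolutely_continuous_on a b F.
Proof.
move=> ab dF cf; have [M fM] := continuous_bounded_itv R a b f ab cf.
have acid := absolutely_continuous_id R a b.
apply: (@absolutely_continuous_dominated R a b M id id) => // u v au uv vb.
have M0 : 0 <= M by apply: le_trans (fM a (lexx _) ab).
have [||c cuv ->] := @MVT_segment R F f u v uv.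
- by move=> x; rewrite in_itv/= => /andP[ux xv]; apply: dF; lra.
- apply: derivable_within_continuous => x; rewrite in_itv/= => /andP[ux xv].
  by have [] := dF x (le_trans au ux) (le_trans xv vb).
move: cuv; rewrite in_itv/= => /andP[uc cv].
rewrite normrM; apply: (@le_trans _ _ (M * `|v - u|)).
  by rewrite ler_wpM2r// fM//; lra.
by rewrite ler_wpM2l// lerDl.
Qed.

(** * Primitives of continuous functions *)

Lemma continuous_antiderivative (R : realType) (a : R) (f : R -> R) :
  (forall x, a <= x -> {for x, continuous f}) ->
  forall x, a < x -> is_derive x 1
    (fun t : R => \int[@lebesgue_measure R]_(s in `[a, t]) f s) (f x).
Proof.
move=> cf x ax.
have [||dF dFE] := @continuous_FTC1_closed R f a x (x + 1) _ _ ax (cf x (ltW ax)).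
- by rewrite ltrDl.
- apply: continuous_compact_integrable; first exact: segment_compact.
  apply: continuous_in_subspaceT => z /set_mem; rewrite /= in_itv/= => /andP[az _].
  exact: cf.
by apply: DeriveDef; [exact: dF|rewrite -derive1E; exact: dFE].
Qed.

Lemma is_derive_continuous (R : realType) (x l : R) (f : R -> R) :
  is_derive x 1 f l -> {for x, continuous f}.
Proof. by move=> [dx _]; apply: differentiable_continuous; apply/derivable1_diffP. Qed.

(** * Divergence of the integral of an inverse *)

(** On [a, b] the integrand is at least [1 / (M t)], whose integral is
    [(ln b - ln a) / M]. *)
Lemma integral_inverse_linear_infinite (R : realType) (t0 M T : R) (Q : R -> R) :
  {within `[t0, +oo[, continuous Q} ->
  (forall t, t0 <= t -> 0 < Q t) ->
  (forall t, t0 <= t -> T <= t -> Q t <= M * t) ->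
  (\int[@completed_lebesgue_measure R]_(tau in `[t0, +oo[)
     ((Q tau)^-1)%:E = +oo)%E.
Proof.
move=> cQ Q0 QM.
have mQ : measurable_fun (`[t0, +oo[ : set (measurableTypeR R)) (fun t => ((Q t)^-1)%:E).
  apply/measurable_EFinP; apply: subspace_continuous_measurable_fun => //.
  apply/subspace_continuousP => x /= xt; apply: cvgV; last first.
    by move/subspace_continuousP : cQ; apply.
  by rewrite gt_eqF// Q0//; move: xt; rewrite in_itv/= andbT.
have Qi t : t \in `[t0, +oo[%classic -> (0 <= ((Q t)^-1)%:E)%E.
  by rewrite inE/= in_itv/= andbT => /Q0 Qt; rewrite lee_fin invr_ge0 ltW.
rewrite ge0_integral_completed//.
pose a := Num.max (Num.max t0 T) 1.
have [[t0a Ta] a1] : (t0 <= a /\ T <= a) /\ 1 <= a.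
  by rewrite /a !le_max !lexx/= !orbT.
have a0 : 0 < a by lra.
have M0 : 0 < M.
  have := QM a t0a Ta; have := Q0 a t0a => Qa QMa.
  by rewrite -(@pmulr_lgt0 _ a)// (lt_le_trans Qa).
have cMx b : {within `[a, b], continuous (fun x => (M * x)^-1)}.
  apply: continuous_in_subspaceT => x /set_mem; rewrite /= in_itv/= => /andP[ax _].
  have Mx0 : M * x != 0 by rewrite gt_eqF// mulr_gt0//; lra.
  exact: is_derive_continuous (@is_deriveV _ (fun x => M * x) x _ 1 Mx0
     (is_deriveZ M (is_derive_id x 1))).
have FTC b : a < b -> (\int[@lebesgue_measure R]_(x in `[a, b]) ((M * x)^-1)%:E =
   (M^-1 * ln b)%:E - (M^-1 * ln a)%:E)%E.
  move=> ab.
  have dl x : a <= x -> is_derive x 1 (fun x => M^-1 * ln x) ((M * x)^-1).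
    move=> ax; have x0 : 0 < x by lra.
    rewrite invfM.
    exact: (is_deriveZ M^-1 (is_derive1_ln x0)).
  have cl x : a <= x -> {for x, continuous (fun x => M^-1 * ln x)}.
    by move=> /dl; exact: is_derive_continuous.
  apply: (@continuous_FTC2 R (fun x => (M * x)^-1) (fun x => M^-1 * ln x) a b ab).
  - exact: cMx.
  - split.
    + by move=> x; rewrite in_itv/= => /andP[ax _]; have [] := dl x (ltW ax).
    + by apply: cvg_at_right_filter; exact: cl.
    + by apply: cvg_at_left_filter; apply: cl; exact: ltW.
  - move=> x; rewrite in_itv/= => /andP[ax _]; have [_ <-] := dl x (ltW ax).
    by rewrite derive1E.
apply/eqyP => A A0.
(* chosen so that [(ln b - ln a) / M] exceeds [A] *)
pose b := expR (M * A + ln a + 1).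
have lnab : ln a < ln b by rewrite /b expRK; nra.
have ab : a < b by rewrite -ltr_ln// ?posrE// expR_gt0.
apply: (@le_trans _ _ (\int[@lebesgue_measure R]_(x in `[a, b]) ((M * x)^-1)%:E)%E).
  rewrite (FTC b ab) -EFinB lee_fin -mulrBr mulrC ler_pdivlMr// /b expRK; lra.
have sub : `[a, b] `<=` `[t0, +oo[.
  by move=> x /=; rewrite !in_itv/= andbT => /andP[ax _]; exact: le_trans ax.
apply: (@le_trans _ _ (\int[@lebesgue_measure R]_(x in `[a, b]) ((Q x)^-1)%:E)%E).
  apply: ge0_le_integral => //.
  - move=> x /=; rewrite in_itv/= => /andP[ax _].
    by rewrite lee_fin invr_ge0 mulr_ge0//; lra.
  - apply/measurable_EFinP; exact: subspace_continuous_measurable_fun (cMx b).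
  - exact: measurable_funS mQ.
  - move=> x xab; have := sub _ xab; move: xab; rewrite /= !in_itv/= andbT => /andP[ax _] t0x.
    rewrite lee_fin lef_pV2 ?posrE ?Q0//; last by rewrite mulr_gt0//; lra.
    by apply: QM => //; lra.
apply: ge0_subset_integral => //.
by move=> x xt; apply: Qi; rewrite inE.
Qed.

(** * From the differential equation to the Riccati equation *)

Lemma iterated_integral_primitive (R : realType) (t0 : R) (q : R -> R) :
  locally_integrable_from t0 q ->
  exists P : R -> R,
  [/\ forall a b, absolutely_continuous_on a b P,
      {ae @lebesgue_measure R, forall x : R, t0 <= x -> is_derive x 1 P (q x)} &
      forall x, t0 < x -> is_derive x 1 (iterated_integral t0 q) (P x)].
Proof.
move=> hq; have [f [mf intf fq qf]] := locally_integrable_representative R t0 q hq.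
pose P (x : R) : R := \int[@lebesgue_measure R]_(s in `]-oo, x]) f s.
have acP a b : absolutely_continuous_on a b P.
  exact: (absolutely_continuous_integral R f a b (intf b)).
have cP x : {for x, continuous P}.
  by apply: (absolutely_continuous_on_continuous R (x - 1) (x + 1)) => //; lra.
exists P; split => //.
- have := ae_is_derive_integral R f mf intf; move: fq.
  apply: filterS2; first exact: (ae_filter_ringOfSetsType (@lebesgue_measure R)).
  by move=> x fqx dP t0x; rewrite -(fqx t0x).
- have -> : iterated_integral t0 q = fun t : R => \int[@lebesgue_measure R]_(s in `[t0, t]) P s.
    apply/funext => t; rewrite /iterated_integral /Rintegral.
    under eq_integral do rewrite -/(Rintegral _ _ _) qf.
    rewrite integral_completed//; apply/measurable_EFinP; apply: measurable_funTS.
    exact: continuous_measurable_fun.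
  by move=> x; apply: continuous_antiderivative => *; exact: cP.
Qed.

Lemma solution_derivatives (R : realType) (t0 : R) (q phi : R -> R) :
  is_solution t0 q phi ->
  exists psi : R -> R,
  [/\ forall x, t0 < x -> is_derive x 1 phi (psi x),
      forall a b, t0 <= a -> a <= b -> absolutely_continuous_on a b psi &
      {ae @lebesgue_measure R, forall x : R, t0 < x -> is_derive x 1 psi (- (q x * phi x))}].
Proof.
move=> [psi [dphi acpsi eqn]]; exists psi; split.
- move=> x t0x; apply: is_derivative_from_is_derive t0x (dphi x (ltW t0x)).
- move=> a b t0a ab e e0; have [d d0 hd] := acpsi b (le_trans t0a ab) e e0.
  exists d => // s sab; apply: hd; apply: sub_all sab => p /andP[/andP[ap -> ->]].
  by rewrite (le_trans t0a ap).
- move/completed_negligible : eqn; apply: negligibleS => x /= nx h; apply: nx => t0x.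
  have [l dl /eqP] := h (ltW t0x); rewrite addr_eq0 => /eqP le.
  by rewrite -le; apply: is_derivative_from_is_derive t0x dl.
Qed.

(** The function [psi / phi + P + W] is absolutely continuous on [a, b], and its
    derivative [psi' / phi - (psi / phi)^2 + q + (psi / phi)^2] vanishes almost
    everywhere since [psi' = - q phi]. *)
Lemma riccati_identity (R : realType) (a b : R) (q phi psi P W : R -> R) :
  a <= b ->
  (forall x, a <= x -> x <= b -> phi x != 0) ->
  (forall x, a <= x -> x <= b -> is_derive x 1 phi (psi x)) ->
  (forall x, a <= x -> x <= b -> {for x, continuous psi}) ->
  absolutely_continuous_on a b psi ->
  absolutely_continuous_on a b P ->
  {ae @lebesgue_measure R, forall x : R, a < x -> is_derive x 1 psi (- (q x * phi x))} ->
  {ae @lebesgue_measure R, forall x : R, a < x -> is_derive x 1 P (q x)} ->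
  (forall x, a <= x -> x <= b -> is_derive x 1 W ((psi x / phi x) ^+ 2)) ->
  psi b / phi b + P b + W b = psi a / phi a + P a + W a.
Proof.
move=> ab phi0 dphi cpsi acpsi acP dpsi dP dW.
have cphi x : a <= x -> x <= b -> {for x, continuous phi}.
  by move=> ax xb; exact: is_derive_continuous (dphi x ax xb).
have cV x : a <= x -> x <= b -> {for x, continuous (fun x => (phi x)^-1)}.
  by move=> ax xb; apply: cvgV; [exact: phi0|exact: cphi].
have cy x : a <= x -> x <= b -> {for x, continuous (fun x => psi x / phi x)}.
  by move=> ax xb; apply: cvgM; [exact: cpsi|exact: cV].
have dV x : a <= x -> x <= b -> is_derive x 1 (fun x => (phi x)^-1) (- (phi x) ^- 2 * psi x).
  by move=> ax xb; exact: is_deriveV (phi0 x ax xb) (dphi x ax xb).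
have acV : absolutely_continuous_on a b (fun x => (phi x)^-1).
  apply: absolutely_continuous_derive ab dV _ => x ax xb.
  apply: cvgM; last exact: cpsi.
  apply: cvgN; apply: cvgV; first by rewrite expf_neq0// phi0.
  by apply: cvgM; exact: cphi.
have [M1 psiM] := continuous_bounded_itv R a b psi ab cpsi.
have [M2 phiM] := continuous_bounded_itv R a b _ ab cV.
have acy : absolutely_continuous_on a b (fun x => psi x / phi x).
  apply: (absolutely_continuousM R a b (Num.max M1 M2)) => // x ax xb.
  by split; rewrite le_max (psiM _ ax xb, phiM _ ax xb) ?orbT.
have acW : absolutely_continuous_on a b W.
  apply: absolutely_continuous_derive ab dW _ => x ax xb.
  by apply: cvgM; exact: cy.
apply: (ac_derive0_ae_eq R a b (fun x => psi x / phi x + P x + W x)) => //.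
  by apply: absolutely_continuousD => //; exact: absolutely_continuousD.
move: dpsi dP; apply: filterS2; first exact: (ae_filter_ringOfSetsType (@lebesgue_measure R)).
move=> x /= dpsix dPx ax xb.
have ax' := ltW ax; have xb' := ltW xb.
apply: (is_derive_eq (is_deriveD (is_deriveD (is_deriveM (dpsix ax) (dV x ax' xb')) (dPx ax)) (dW x ax' xb'))).
by rewrite /GRing.scale/=; field; exact: phi0.
Qed.

Theorem corollary1 (R : realType) (t0 : R) (q : R -> R)
  (hq : locally_integrable_from t0 q)
  (lambda : R)
  (hA : t^-1 * iterated_integral t0 q t @[t --> +oo] --> lambda)
  (Q0 Q1 : R -> R)
  (hQ0c : {within `[t0, +oo[, continuous Q0})
  (hQ1c : {within `[t0, +oo[, continuous Q1})
  (hQ0pos : forall t, t0 <= t -> 0 < Q0 t)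
  (hQ0int : (\int[@completed_lebesgue_measure R]_(tau in `[t0, +oo[)
               ((Q0 tau)^-1)%:E < +oo)%E)
  (hQ1sup : (ereal_sup [set (Q1 t)%:E | t in `[t0, +oo[] < +oo)%E)
  (hB : \forall t \near +oo,
          t^-1 * iterated_integral t0 q t
            <= lambda - ln (Q0 t) / (4 * t) + Q1 t / t) :
  oscillatory t0 q.
Proof.
move=> phi /solution_derivatives[psi [dphi acpsi dpsi]] T; apply: contrapT => nz.
have [P [acP dP dI]] := iterated_integral_primitive R t0 q hq.
move: (iterated_integral t0 q) hA hB dI => I hA hB dI.
have cP x : {for x, continuous P}.
  by apply: (absolutely_continuous_on_continuous R (x - 1) (x + 1)) => //; lra.
(* [+ 1] keeps [a0] off the boundary point [t0], where derivatives are one-sided *)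
pose a0 := Num.max (Num.max t0 T) 0 + 1.
have [t0a0 [Ta0 a00]] : t0 < a0 /\ T < a0 /\ 0 < a0.
  by rewrite /a0 !ltr_pwDr// !le_max lexx ?orbT.
have phi0 x : a0 <= x -> phi x != 0.
  by move=> ax; apply/eqP => phix; apply: nz; exists x; split => //; lra.
have cpsi x : a0 <= x -> {for x, continuous psi}.
  move=> ax; apply: (absolutely_continuous_on_continuous R t0 (x + 1)); last 2 first.
  - exact: lt_le_trans ax.
  - by rewrite ltrDl.
  by apply: acpsi => //; lra.
have dphi' x : a0 <= x -> is_derive x 1 phi (psi x).
  by move=> ax; apply: dphi; exact: lt_le_trans ax.
pose y (x : R) : R := psi x / phi x.
have cy x : a0 <= x -> {for x, continuous y}.
  move=> ax; apply: cvgM; first exact: cpsi.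
  by apply: cvgV; [exact: phi0|exact: is_derive_continuous (dphi' x ax)].
have cy2 x : a0 <= x -> {for x, continuous (fun x => y x ^+ 2)}.
  by move=> ax; apply: cvgM; exact: cy.
have [W0 dW0] : exists W0 : R -> R, forall x, a0 < x -> is_derive x 1 W0 (y x ^+ 2).
  by eexists; exact: continuous_antiderivative cy2.
(* the primitives [W0] and [V] are integrals from [a0] and [a0 + 1], and are
   differentiable only beyond these points *)
pose a := a0 + 2.
pose W (x : R) : R := W0 x - W0 a.
have dW x : a0 < x -> is_derive x 1 W (y x ^+ 2).
  move=> ax; exact: (is_derive_eq (is_deriveB (dW0 x ax) (is_derive_cst (W0 a) x 1)) (subr0 _)).
have [V dV] : exists V : R -> R, forall x, a <= x -> is_derive x 1 V (W x).
  have cW x : a0 + 1 <= x -> {for x, continuous W}.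
    by move=> ax; apply: is_derive_continuous (dW x _); lra.
  eexists => x ax; apply: (continuous_antiderivative R _ _ cW); rewrite /a in ax; lra.
pose c := y a + P a + W a.
have riccati b : a <= b -> y b = c - P b - W b.
  move=> ab; suff : y b + P b + W b = c by lra.
  have aa x : a <= x -> a0 < x by rewrite /a; lra.
  apply: (riccati_identity R a b q phi psi P W ab).
  - by move=> x /aa/ltW/phi0.
  - by move=> x /aa/ltW/dphi'.
  - by move=> x /aa/ltW/cpsi.
  - by apply: acpsi => //; rewrite /a; lra.
  - exact: acP.
  - move: dpsi; apply: filterS; first exact: (ae_filter_ringOfSetsType (@lebesgue_measure R)).
    by move=> x /= + ax; apply; rewrite /a in ax; lra.
  - move: dP; apply: filterS; first exact: (ae_filter_ringOfSetsType (@lebesgue_measure R)).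
    by move=> x /= + ax; apply; rewrite /a in ax; lra.
  - by move=> x /aa ax _; exact: dW.
pose Y (x : R) : R := c * x - I x - V x.
have dY x : a <= x -> is_derive x 1 Y (y x).
  move=> ax; rewrite (riccati x ax).
  have t0x : t0 < x by rewrite /a in ax; lra.
  exact: (is_derive_eq (is_deriveB (is_deriveB (is_deriveZ c (is_derive_id x 1)) (dI x t0x)) (dV x ax))
    (congr1 (fun z => z - _ - _) (mulr1 _))).
have [K defK] : exists K, forall t, a <= t -> lambda * t - I t <= ln t / 4 + K.
  apply: (riccati_deficit_bound R a c lambda I V W y Y) => //.
  - by rewrite /a; lra.
  - by move=> t at_; apply: dW; rewrite /a in at_; lra.
  - by rewrite /W subrr.
have [C defC] : exists C, forall t, t0 <= t -> Q1 t <= C.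
  move: hQ1sup; set S := ereal_sup _ => Soo.
  have le_S t : t0 <= t -> ((Q1 t)%:E <= S)%E.
    by move=> t0t; apply: ereal_sup_ubound; exists t => //=; rewrite in_itv/= t0t.
  exists (fine S) => t t0t; rewrite -lee_fin fineK ?le_S// fin_numE -ltey Soo andbT.
  by rewrite -ltNye (lt_le_trans _ (le_S t t0t))// ltNyr.
have [T1 aT1 hB1] := near_pinfty_ge R a _ hB.
have QM t : t0 <= t -> T1 <= t -> Q0 t <= expR (4 * (K + C)) * t.
  move=> t0t T1t; have Qt := hQ0pos t t0t.
  have t_gt0 : 0 < t by rewrite /a in aT1; lra.
  have at_ : a <= t by lra.
  rewrite -ler_ln ?posrE ?mulr_gt0 ?expR_gt0// lnM ?posrE ?expR_gt0// expRK.
  have := defK t at_; have := defC t t0t.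
  have := hB1 t T1t; rewrite ler_pdivrMl// => h.
  have : t * (lambda - ln (Q0 t) / (4 * t) + Q1 t / t) = lambda * t - ln (Q0 t) / 4 + Q1 t.
    by field; exact: lt0r_neq0.
  by move=> e; rewrite e in h; lra.
by move: hQ0int; rewrite (integral_inverse_linear_infinite R t0 _ T1 Q0 hQ0c hQ0pos QM) ltxx.
Qed.
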